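(* For integers $i\ge 1$ and $j\ge0$, the asymptotic graded Betti numbers for the cut ideal on a binary ($k=2$) tree are given by $$\beta_{i,j}(J_{2,\infty})=\frac{[2(j-i)]!}{(j-i+1)\,(j-i)\,(j-i)!\,(j-2i)!\,(i-1)!}\qquad\text{for } j\ge 2i,$$ and $\beta_{i,j}(J_{2,\infty})=0$ otherwise.
   Context: The asymptotic graded Betti numbers $\beta_{i,j}(J_{2,\infty})$ are by definition the coefficients of $x^it^j$ in the formal power series expansion of the generating function $$G_{2,\infty}(x,t)=-\frac12\cdot\frac{\bigl(2t-1+2t^2x+\sqrt{1-4t-4t^2x}\bigr)\,x}{(1+xt)^2}=\sum_{i,j}\beta_{i,j}(J_{2,\infty})\,x^it^j ,$$ where the square root denotes the formal power series with constant term $1$. *)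

(* Defs.v *)
From HB Require Import structures.
From mathcomp Require Import all_boot all_order all_algebra.
From mathcomp Require Import boolp.
From mathcomp Require Import ring.

Set Implicit Arguments.
Unset Strict Implicit.
Unset Printing Implicit Defensive.

Import Order.TTheory GRing.Theory Num.Theory.
Local Open Scope ring_scope.

(* Formal power series over R; the coercion [coefs] makes [f n] the
   coefficient of degree n. *)
Record fps (R : Type) := Fps { coefs :> nat -> R }.

Lemma fpsP (R : Type) (f g : fps R) : (forall n, f n = g n) -> f = g.
Proof. by case: f g => [f] [g] /= fg; congr Fps; apply/funext. Qed.

HB.instance Definition _ (R : Type) := gen_eqMixin (fps R).
HB.instance Definition _ (R : Type) := gen_choiceMixin (fps R).

Section Zmodule.
Variable R : zmodType.
Implicit Types f g h : fps R.

Definition fps0 : fps R := Fps (fun=> 0).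
Definition fps_add f g : fps R := Fps (fun n => f n + g n).
Definition fps_opp f : fps R := Fps (fun n => - f n).

Fact fps_addA : associative fps_add.
Proof. by move=> f g h; apply: fpsP => n /=; rewrite addrA. Qed.
Fact fps_addC : commutative fps_add.
Proof. by move=> f g; apply: fpsP => n /=; rewrite addrC. Qed.
Fact fps_add0 : left_id fps0 fps_add.
Proof. by move=> f; apply: fpsP => n /=; rewrite add0r. Qed.
Fact fps_addN : left_inverse fps0 fps_opp fps_add.
Proof. by move=> f; apply: fpsP => n /=; rewrite addNr. Qed.

HB.instance Definition _ :=
  GRing.isZmodule.Build (fps R) fps_addA fps_addC fps_add0 fps_addN.

Lemma fps0E n : (0 : fps R) n = 0. Proof. by []. Qed.
Lemma fpsDE f g n : (f + g) n = f n + g n. Proof. by []. Qed.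
Lemma fpsNE f n : (- f) n = - f n. Proof. by []. Qed.
Lemma fpsBE f g n : (f - g) n = f n - g n. Proof. by []. Qed.

End Zmodule.

Definition fpsC (R : zmodType) (c : R) : fps R :=
  Fps (fun n => if n == 0%N then c else 0).

Definition fpsX (R : comNzRingType) : fps R := Fps (fun n => (n == 1%N)%:R).

Section Ring.
Variable R : comNzRingType.
Implicit Types f g h : fps R.

Definition fps_mul f g : fps R :=
  Fps (fun n => \sum_(k < n.+1) f k * g (n - k)%N).

Let trunc m f : {poly R} := \poly_(k < m.+1) f k.

Let mul_trunc m n f g : (n <= m)%N ->
  fps_mul f g n = (trunc m f * trunc m g)`_n.
Proof.
move=> nm; rewrite coefM /=; apply: eq_bigr => k _; rewrite !coef_poly.
have km : (k < m.+1)%N by apply: leq_trans (ltn_ord k) _.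
by rewrite km ltnS (leq_trans (leq_subr k n) nm).
Qed.

Fact fps_mulC : commutative fps_mul.
Proof.
move=> f g; apply: fpsP => n.
by rewrite !(mul_trunc _ _ (leqnn n)) mulrC.
Qed.

Fact fps_mulA : associative fps_mul.
Proof.
move=> f g h; apply: fpsP => n.
have -> : fps_mul f (fps_mul g h) n = (trunc n f * (trunc n g * trunc n h))`_n.
  rewrite coefM /=; apply: eq_bigr => k _.
  by rewrite coef_poly ltn_ord -(mul_trunc _ _ (leq_subr k n)).
have -> // : fps_mul (fps_mul f g) h n
           = (trunc n f * (trunc n g * trunc n h))`_n.
rewrite mulrA coefM /=; apply: eq_bigr => k _.
have kn : (k <= n)%N by rewrite -ltnS.
by rewrite -(mul_trunc _ _ kn) coef_poly ltnS leq_subr.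
Qed.

Fact fps_mul1 : left_id (fpsC 1) fps_mul.
Proof.
move=> f; apply: fpsP => n /=; rewrite big_ord_recl /= mul1r subn0.
by rewrite big1 ?addr0 // => k _; rewrite mul0r.
Qed.

Fact fps_mulDl : left_distributive fps_mul +%R.
Proof.
move=> f g h; apply: fpsP => n; rewrite fpsDE /= -big_split /=.
by apply: eq_bigr => k _; rewrite mulrDl.
Qed.

Fact fps1_neq0 : fpsC 1 != 0 :> fps R.
Proof.
apply/eqP => /(congr1 (fun f : fps R => f 0%N)) /= /eqP.
by rewrite oner_eq0.
Qed.

HB.instance Definition _ := GRing.Zmodule_isComNzRing.Build (fps R)
  fps_mulA fps_mulC fps_mul1 fps_mulDl fps1_neq0.

Lemma fps1E n : (1 : fps R) n = (n == 0%N)%:R.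
Proof. by case: n. Qed.

Lemma fpsME f g n : (f * g) n = \sum_(k < n.+1) f k * g (n - k)%N.
Proof. by []. Qed.

Lemma fpsM0 f g : (f * g) 0%N = f 0%N * g 0%N.
Proof. by rewrite fpsME big_ord1. Qed.

Lemma fpsCM c f n : (fpsC c * f) n = c * f n.
Proof.
rewrite fpsME big_ord_recl subn0 big1 ?addr0 // => k _.
by rewrite /= mul0r.
Qed.

Definition vanish n f := forall m, (m < n)%N -> f m = 0.

Lemma vanishM n m f g : vanish n f -> vanish m g -> vanish (n + m) (f * g).
Proof.
move=> fn gm d dnm; rewrite fpsME big1 // => k _.
have [kn|nk] := ltnP k n; first by rewrite fn ?mul0r.
have kd : (k <= d)%N by rewrite -ltnS.
by rewrite gm ?mulr0 // ltn_subLR // (leq_trans dnm) // leq_add2r.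
Qed.

Lemma vanishMl n f g : vanish n g -> vanish n (f * g).
Proof. by move=> gn; rewrite -[n]add0n; apply: vanishM => // -[]. Qed.

Lemma vanishD n f g : vanish n f -> vanish n g -> vanish n (f + g).
Proof. by move=> fn gn m mn; rewrite fpsDE fn ?gn ?addr0. Qed.

Lemma vanish_eq0 f : (forall n, vanish n f) -> f = 0.
Proof. by move=> fn; apply: fpsP => n; rewrite (fn n.+1). Qed.

Lemma vanishW m n f : (n <= m)%N -> vanish m f -> vanish n f.
Proof. by move=> nm fm k kn; apply: fm; apply: leq_trans nm. Qed.

Definition fps_lim (u : nat -> fps R) : fps R := Fps (fun n => u n n).

Lemma fps_limP (u : nat -> fps R) n :
  (forall n, vanish n.+1 (u n.+1 - u n)) -> vanish n.+1 (fps_lim u - u n).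
Proof.
move=> du m; rewrite ltnS fpsBE /= => /subnKC <-.
elim: (n - m)%N => [|k IH]; first by rewrite addn0 subrr.
have := du (m + k)%N m; rewrite ltnS leq_addr fpsBE addnS => /(_ isT)/eqP.
by rewrite subr_eq0 => /eqP ->.
Qed.

End Ring.

Section Inverse.
Variable R : comUnitRingType.
Implicit Types f g : fps R.

Definition fps_unit : {pred fps R} := fun f => f 0%N \is a GRing.unit.

(* Starting from v = 1 / f(0), each step v := v + (1 - f v) / f(0) makes
   f v - 1 vanish to one more order. *)
Definition fps_inv_approx f n : fps R :=
  iter n (fun v => v + fpsC (f 0%N)^-1 * (1 - f * v)) (fpsC (f 0%N)^-1).

Definition fps_inv f : fps R :=
  if f \in fps_unit then fps_lim (fps_inv_approx f) else f.

Let inv_err f n : f \in fps_unit -> vanish n.+1 (1 - f * fps_inv_approx f n).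
Proof.
move=> fu; elim: n => [|n IH] /=.
  by case=> // _; rewrite fpsBE fpsM0 /= divrr // subrr.
set v := fps_inv_approx f n in IH *; set c := fpsC _.
have -> : 1 - f * (v + c * (1 - f * v)) = (1 - f * v) * (1 - f * c) by ring.
rewrite -[n.+2]addn1; apply: vanishM => // -[] // _.
by rewrite fpsBE fpsM0 /= divrr // subrr.
Qed.

Fact fps_mulVx : {in fps_unit, left_inverse 1 fps_inv *%R}.
Proof.
move=> f fu; rewrite /fps_inv fu mulrC; apply/eqP; rewrite eq_sym -subr_eq0.
apply/eqP/vanish_eq0 => n; apply: (@vanishW _ n.+1) => //.
set v := fps_inv_approx f.
have -> : 1 - f * fps_lim v = (1 - f * v n) + - f * (fps_lim v - v n) by ring.
apply: vanishD; first exact: inv_err.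
apply/vanishMl/fps_limP => {}n; rewrite /v /= addrC addKr.
exact/vanishMl/inv_err.
Qed.

Fact fps_unitPl f g : g * f = 1 -> fps_unit f.
Proof.
move=> /(congr1 (fun h : fps R => h 0%N)); rewrite fpsM0 fps1E /= => gf.
by apply/unitrP; exists (g 0%N); rewrite [f 0%N * _]mulrC.
Qed.

Fact fps_inv_out : {in [predC fps_unit], fps_inv =1 id}.
Proof. by move=> f; rewrite inE /fps_inv => /negbTE ->. Qed.

HB.instance Definition _ := GRing.ComNzRing_hasMulInverse.Build (fps R)
  fps_mulVx fps_unitPl fps_inv_out.

Lemma fps_unitE f : (f \is a GRing.unit) = (f 0%N \is a GRing.unit).
Proof. by []. Qed.

(* Square root of f with prescribed constant coefficient a. *)
Definition fps_sqrt_approx (a : R) f n : fps R :=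
  iter n (fun s => s + fpsC (2 * a)^-1 * (f - s ^+ 2)) (fpsC a).

Definition fps_sqrt (a : R) f : fps R := fps_lim (fps_sqrt_approx a f).

Let sqrt_coef0 a f n : f 0%N = a ^+ 2 -> fps_sqrt_approx a f n 0%N = a.
Proof.
move=> fa; elim: n => // n IH; rewrite /fps_sqrt_approx iterS.
rewrite -/(fps_sqrt_approx a f n) fpsDE IH.
by rewrite fpsM0 fpsBE expr2 fpsM0 IH fa expr2 subrr mulr0 addr0.
Qed.

Lemma fps_sqrt_coef0 a f : fps_sqrt a f 0%N = a.
Proof. by []. Qed.

Lemma fps_sqr_sqrt a f : 2 * a \is a GRing.unit -> f 0%N = a ^+ 2 ->
  fps_sqrt a f ^+ 2 = f.
Proof.
move=> au fa; set s := fps_sqrt_approx a f; set c := fpsC (2 * a)^-1.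
have err n : vanish n.+1 (f - s n ^+ 2).
  elim: n => [|n IH]; first by case=> // _; rewrite fpsBE fa expr2 fpsM0 subrr.
  rewrite [s n.+1]/= -/(s n) -/c; set e := f - s n ^+ 2.
  have -> : f - (s n + c * e) ^+ 2 = e * (1 - 2 * c * s n - c ^+ 2 * e).
    by rewrite /e; ring.
  rewrite -[n.+2]addn1; apply: vanishM => // -[] // _.
  have f2 : (2 : fps R) 0%N = 2 by [].
  rewrite !fpsBE fps1E !fpsM0 (IH 0%N) // mulr0 subr0 sqrt_coef0 // f2.
  by rewrite -mulrA [_ * a]mulrC mulrA divrr // subrr.
apply/eqP; rewrite eq_sym -subr_eq0.
apply/eqP/vanish_eq0 => n; apply: (@vanishW _ n.+1) => //.
have -> : f - fps_sqrt a f ^+ 2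
        = (f - s n ^+ 2) + - (fps_sqrt a f + s n) * (fps_sqrt a f - s n) by ring.
apply: vanishD => //.
apply/vanishMl/fps_limP => {}n; rewrite /s /= addrC addKr.
exact/vanishMl/err.
Qed.

End Inverse.

(* Q[[x, t]] as Q[[t]][[x]]: the coefficient of x^i t^j in F is [F i j]. *)
Notation fps2 := (fps (fps rat)).

Definition var_x : fps2 := fpsX (fps rat).
Definition var_t : fps2 := fpsC (fpsX rat).

(* The square root with constant term 1, for F with constant term 1: see
   [sqr_sqrt2] and [sqrt2_unique]. *)
Definition sqrt2 (F : fps2) : fps2 := fps_sqrt (fps_sqrt 1 (F 0%N)) F.

Lemma sqrt2_constant_term (F : fps2) : sqrt2 F 0%N 0%N = 1.
Proof. by []. Qed.

Lemma sqr_sqrt2 (F : fps2) : F 0%N 0%N = 1 -> sqrt2 F ^+ 2 = F.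
Proof.
move=> F1; have F0 : F 0%N = fps_sqrt 1 (F 0%N) ^+ 2.
  by rewrite fps_sqr_sqrt // F1 expr1n.
by apply: fps_sqr_sqrt => //; rewrite fps_unitE fpsM0 fps_sqrt_coef0.
Qed.

Lemma sqrt2_unique (F S : fps2) :
  F 0%N 0%N = 1 -> S 0%N 0%N = 1 -> S ^+ 2 = F -> S = sqrt2 F.
Proof.
move=> F1 S1 SF; apply/eqP; rewrite -subr_eq0; apply/eqP.
have u : S + sqrt2 F \is a GRing.unit.
  by rewrite !fps_unitE !fpsDE S1 sqrt2_constant_term.
by apply: (mulIr u); rewrite mul0r -subr_sqr sqr_sqrt2 // SF subrr.
Qed.

Definition G_2_infty : fps2 :=
  let x := var_x in
  let t := var_t in
  - 2^-1 * ((2 * t - 1 + 2 * t ^+ 2 * x + sqrt2 (1 - 4 * t - 4 * t ^+ 2 * x))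
            * x / (1 + x * t) ^+ 2).

Lemma radicand_constant_term :
  (1 - 4 * var_t - 4 * var_t ^+ 2 * var_x) 0%N 0%N = 1.
Proof. by rewrite !fpsBE !fpsM0 /= !mulr0 !subr0. Qed.

Lemma G_2_infty_units :
  ((2 : fps2) \is a GRing.unit) * ((1 + var_x * var_t) ^+ 2 \is a GRing.unit).
Proof.
split; first by rewrite !fps_unitE.
by rewrite unitrX // fps_unitE fpsDE fpsM0 mul0r addr0 unitr1.
Qed.

Definition betti_J_2_infty (i j : nat) : rat := G_2_infty i j.

(* Main.v *)
Require Import Defs.
From HB Require Import structures.
From mathcomp Require Import all_boot all_order all_algebra.
From mathcomp Require Import ring zify.
Import GRing.Theory.
Local Open Scope ring_scope.

(** Put u = t + t^2 x = t (1 + x t). The radicand is 1 - 4 u and the polynomial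
    in front of the square root is 2 u - 1, so that, up to the factor
    x / (1 + x t)^2, the generating function is a univariate series evaluated
    at u. The Catalan expansion
      sqrt (1 - 4 X) = 1 - 2 X - 2 X^2 (C_1 + C_2 X + C_3 X^2 + ...)
    cancels the 2 u - 1 and leaves a factor u^2 = t^2 (1 + x t)^2, which cancels
    the denominator. Hence G = x t^2 (C_1 + C_2 u + C_3 u^2 + ...).
    By the binomial theorem, u^n contributes to x^i t^j only for n = j - i,
    with coefficient binomial(n, i). Since the factor x t^2 shifts i by 1 and
    j by 2, the Betti number is
      C_(j-i) * binomial(j-i-1, i-1)    if j > i,
    and 0 if j <= i. For j >= 2 i the product is the quotient of factorials in
    the theorem; for i < j < 2 i the binomial coefficient vanishes.

    The proof rests on two points. Evaluation at u is defined by
    its coefficients and shown to be a ring morphism ([subst_uM]); it thus maps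
    the univariate square root to a square root of 1 - 4 u, and [sqrt2_unique]
    identifies the latter with the one in G. The coefficients of sqrt (1 - 4 X)
    are found from the linear differential equation (1 - 4 X) s' = - 2 s that
    s^2 = 1 - 4 X implies ([sqrt_catalan]). *)

(** * Univariate power series *)

Section Univariate.
Variable R : comNzRingType.
Implicit Types f g : fps R.

Lemma fpsXM f n : (fpsX R * f) n = if n is m.+1 then f m else 0.
Proof.
rewrite fpsME; case: n => [|n]; first by rewrite big_ord1 mul0r.
rewrite big_ord_recl /= mul0r add0r big_ord_recl /= mul1r subSS subn0.
by rewrite big1 ?addr0 // => k _; rewrite mul0r.
Qed.

Lemma fpsC_nat n : (n%:R : fps R) = fpsC n%:R.
Proof.
elim: n => [|n IH]; first by apply: fpsP => -[].
by rewrite -addn1 !natrD IH; apply: fpsP => -[|m] //=; rewrite addr0.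
Qed.

Lemma fps_natM n f k : (n%:R * f) k = n%:R * f k.
Proof. by rewrite fpsC_nat fpsCM. Qed.

Definition fps_tail f : fps R := Fps (fun n => f n.+1).

Lemma fps_head_tail f : f = fpsC (f 0%N) + fpsX R * fps_tail f.
Proof. by apply: fpsP => -[|n]; rewrite fpsDE fpsXM /= ?addr0 ?add0r. Qed.

Definition fps_deriv f : fps R := Fps (fun n => n.+1%:R * f n.+1).

Lemma fps_derivE f n : fps_deriv f n = n.+1%:R * f n.+1.
Proof. by []. Qed.

Lemma fps_derivM f g :
  fps_deriv (f * g) = fps_deriv f * g + f * fps_deriv g.
Proof.
apply: fpsP => n; rewrite fpsDE fps_derivE fpsME mulr_sumr.
(* Split the degree n + 1 of each term between its two factors. *)
transitivity (\sum_(k < n.+2) (k%:R * f k * g (n.+1 - k)%N +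
                               f k * ((n.+1 - k)%N%:R * g (n.+1 - k)%N))).
  apply: eq_bigr => k _; have kn : (k <= n.+1)%N by rewrite -ltnS.
  by rewrite -{1}(subnKC kn) natrD; ring.
rewrite big_split /=; congr (_ + _).
  rewrite big_ord_recl /= !mul0r add0r; apply: eq_bigr => k _.
  by rewrite /= subSS.
rewrite big_ord_recr /= subnn mul0r mulr0 addr0; apply: eq_bigr => k _.
by rewrite /= subSn // -ltnS.
Qed.

End Univariate.

Arguments fps_tail {R}.
Arguments fps_deriv {R}.

(** * The Catalan expansion of the square root of 1 - 4 X *)

Definition catalan (n : nat) : rat := (2 * n)`!%:R / (n`! * n.+1`!)%:R.

Lemma catalanS n :
  n.+2%:R * catalan n.+1 = (4 * n + 2)%:R * catalan n.
Proof.
have nz m : (m`!%:R : rat) != 0 by rewrite Num.Theory.pnatr_eq0 -lt0n fact_gt0.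
have nzS m : (m.+1%:R : rat) != 0 by rewrite Num.Theory.pnatr_eq0.
rewrite /catalan mulnS !addSn add0n !factS !natrM.
by field; rewrite nz -(natrD _ 1) -(natrD _ 2) !nzS.
Qed.

(** Differentiating s^2 = 1 - 4 X and multiplying by s gives the equation
    (1 - 4 X) s' = - 2 s, that is, (n + 1) s_(n+1) = (4 n - 2) s_n. From
    s_0 = 1 this is the recurrence of - 2 C_n, shifted by one degree. *)
Lemma sqrt_catalan (s : fps rat) :
  s 0%N = 1 -> s ^+ 2 = 1 - 4 * fpsX rat ->
  s = 1 - 2 * fpsX rat
      - 2 * (fpsX rat ^+ 2 * Fps (fun n => catalan n.+1)).
Proof.
move=> s0 s2; set X := fpsX rat.
have ode : (1 - 4 * X) * fps_deriv s = - (2 * s).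
  have d : 2 * (s * fps_deriv s) = - 4.
    transitivity (fps_deriv (s ^+ 2)).
      by rewrite expr2 fps_derivM; ring.
    rewrite s2; apply: fpsP => n; rewrite fps_derivE fpsBE fps1E fps_natM.
    by rewrite fpsNE fpsC_nat /=; case: n => [|n] /=; ring.
  have d' : s * fps_deriv s = - 2.
    apply: fpsP => n; have := congr1 (fun f : fps rat => f n) d.
    rewrite fps_natM !fpsNE !fpsC_nat /=.
    case: eqP => _ h; apply: (@mulfI _ (2 : rat)) => //; rewrite h; ring.
  by rewrite -s2 expr2 -mulrA d'; ring.
have rec n : n.+1%:R * s n.+1 = (4 * n%:R - 2) * s n.
  have := congr1 (fun f : fps rat => f n) ode.
  rewrite mulrBl mul1r -mulrA fpsBE fpsNE !fps_natM fpsXM.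
  by case: n => [|n] /= /eqP; rewrite subr_eq => /eqP ->; ring.
have sS n : s n.+1 = - 2 * catalan n.
  elim: n => [|n IH].
    by have := rec 0%N; rewrite s0 /catalan /= !mul1r => ->; rewrite mulr1.
  apply: (@mulfI _ n.+2%:R); first by rewrite Num.Theory.pnatr_eq0.
  by rewrite rec IH [RHS]mulrCA catalanS natrD natrM; ring.
apply: fpsP => n; rewrite !fpsBE !fps_natM fps1E expr2 -mulrA !fpsXM.
have cat0 : catalan 0 = 1 by [].
case: n => [|n]; first by rewrite s0 /=; ring.
by rewrite sS fpsXM; case: n => [|n]; rewrite ?cat0 /=; ring.
Qed.

(** * Evaluation of a univariate series at t + t^2 x *)

Definition var_u : fps2 := var_t * (1 + var_x * var_t).

Lemma var_tM (F : fps2) i j :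
  (var_t * F) i j = if j is k.+1 then F i k else 0.
Proof. by rewrite /var_t fpsCM fpsXM. Qed.

Lemma var_xM (F : fps2) i j :
  (var_x * F) i j = if i is k.+1 then F k j else 0.
Proof. by rewrite fpsXM; case: i. Qed.

Lemma var_uM (F : fps2) i j :
  (var_u * F) i j = (if j is k.+1 then F i k else 0)
    + (if i is h.+1 then if j is k.+2 then F h k else 0 else 0).
Proof.
have -> : var_u * F = var_t * F + var_x * (var_t * (var_t * F)).
  by rewrite /var_u; ring.
by rewrite !fpsDE var_xM !var_tM; case: i j => [|i] [|[|j]]; rewrite ?var_tM.
Qed.

(** The series f(u): x^i t^j occurs in u^n = t^n (1 + x t)^n only if
    n = j - i, with coefficient binomial(n, i). If j < i, then the truncated
    difference is 0 and the binomial coefficient is 0, as it should be. *)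
Definition subst_u (f : fps rat) : fps2 :=
  Fps (fun i => Fps (fun j => f (j - i)%N * 'C(j - i, i)%:R)).

Lemma subst_uE f i j : subst_u f i j = f (j - i)%N * 'C(j - i, i)%:R.
Proof. by []. Qed.

Fact subst_u_zmod : zmod_morphism subst_u.
Proof.
move=> f g; apply: fpsP => i; apply: fpsP => j.
by rewrite !fpsBE !subst_uE fpsBE mulrBl.
Qed.

HB.instance Definition _ :=
  GRing.isZmodMorphism.Build (fps rat) fps2 subst_u subst_u_zmod.

Lemma subst_u1 : subst_u 1 = 1.
Proof.
apply: fpsP => i; apply: fpsP => j; rewrite subst_uE !fps1E.
case: i => [|i]; first by rewrite subn0 bin0 mulr1 fps1E.
by case: (j - i.+1)%N => [|n]; rewrite ?bin0n ?mulr0 ?mul0r.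
Qed.

Lemma subst_u_scale c f : subst_u (fpsC c * f) = fpsC (fpsC c) * subst_u f.
Proof.
apply: fpsP => i; apply: fpsP => j.
by rewrite !fpsCM !subst_uE fpsCM mulrA.
Qed.

(** Multiplying f by X shifts n = j - i by 1, and Pascal's rule splits
    binomial(n, i) into the contributions of the two terms of u. *)
Lemma subst_u_shift f : subst_u (fpsX rat * f) = var_u * subst_u f.
Proof.
apply: fpsP => i; apply: fpsP => j; rewrite var_uM subst_uE fpsXM.
have below h k : (k <= h)%N -> (0 < h)%N -> subst_u f h k = 0.
  rewrite -subn_eq0 subst_uE => /eqP -> h_gt0.
  by rewrite bin_small ?mulr0.
have [ji|ij] := leqP j i.
  move: (ji); rewrite -subn_eq0 => /eqP ->; rewrite mul0r.
  case: i j ji => [|i] [|[|j]] // ji; rewrite ?addr0 //.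
    by rewrite below.
  by rewrite !below ?addr0 //; lia.
case: j ij => // j; rewrite ltnS => ij; rewrite subSn //.
case: i ij => [|i] ij; first by rewrite !subst_uE subn0 !bin0 addr0.
by case: j ij => // j ij; rewrite !subst_uE binS natrD mulrDr subSS.
Qed.

(** Peeling off the constant term of f reduces the defect of multiplicativity
    for f to u times the defect for the tail of f. Iterating, the defect is
    divisible by every power of u, hence by every power of t, and is 0. *)
Lemma subst_uM f g : subst_u (f * g) = subst_u f * subst_u g.
Proof.
apply/eqP; rewrite -subr_eq0; apply/eqP.
pose defect (h : fps rat) : fps2 := subst_u (h * g) - subst_u h * subst_u g.
have defectE h : defect h = var_u * defect (fps_tail h).
  rewrite /defect {1 2}(fps_head_tail _ h) mulrDl !raddfD /= -mulrA.
  rewrite !subst_u_shift subst_u_scale -[fpsC (h 0%N) in X in _ - X]mulr1.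
  by rewrite subst_u_scale subst_u1; ring.
have small n : forall h i j, (j < n)%N -> defect h i j = 0.
  elim: n => // n IH h i j; rewrite ltnS defectE var_uM.
  case: j => [|j] jn; first by case: i => [|i]; rewrite addr0.
  rewrite IH // add0r; case: i j jn => [|i] [|j] // jn.
  by rewrite IH // ltnW.
by apply: fpsP => i; apply: fpsP => j; apply: (small j.+1).
Qed.

Fact subst_u_monoid : monoid_morphism subst_u.
Proof. by split; [exact: subst_u1 | exact: subst_uM]. Qed.

HB.instance Definition _ :=
  GRing.isMonoidMorphism.Build (fps rat) fps2 subst_u subst_u_monoid.

Lemma subst_uX : subst_u (fpsX rat) = var_u.
Proof. by rewrite -[fpsX rat]mulr1 subst_u_shift rmorph1 mulr1. Qed.

(** * The generating function *)

Lemma G_2_infty_catalan :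
  G_2_infty = var_x * (var_t * (var_t * subst_u (Fps (fun n => catalan n.+1)))).
Proof.
set b := Fps _; pose s : fps rat := fps_sqrt 1 (1 - 4 * fpsX rat).
have s2 : s ^+ 2 = 1 - 4 * fpsX rat.
  by apply: fps_sqr_sqrt => //; rewrite expr1n fpsBE fpsM0 mulr0 subr0.
have sqrtE : sqrt2 (1 - 4 * var_t - 4 * var_t ^+ 2 * var_x) = subst_u s.
  apply/esym/sqrt2_unique; first exact: radicand_constant_term.
    by rewrite subst_uE mulr1.
  rewrite -rmorphXn s2 rmorphB rmorph1 rmorphM rmorph_nat /= subst_uX /var_u.
  by ring.
have expansion : subst_u s = 1 - 2 * var_u - 2 * (var_u ^+ 2 * subst_u b).
  rewrite {1}(@sqrt_catalan s) // !rmorphB !rmorphM !rmorph_nat rmorph1 /=.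
  by rewrite subst_uX -expr2.
have [u2 uw] := G_2_infty_units.
rewrite /G_2_infty sqrtE expansion /var_u.
set w := 1 + var_x * var_t in uw *; set B := subst_u b.
have -> : 2 * var_t - 1 + 2 * var_t ^+ 2 * var_x +
    (1 - 2 * (var_t * w) - 2 * ((var_t * w) ^+ 2 * B))
    = - 2 * (var_t * (var_t * B)) * w ^+ 2 by rewrite /w; ring.
rewrite mulrAC mulrK // !mulrA mulrNN mulVr // mul1r.
ring.
Qed.

Lemma catalan_binomial m k :
  catalan (m + k).+1 * 'C(m + k, m)%:R
  = (2 * (m + k).+1)`!%:R
    / ((m + k).+2 * (m + k).+1 * (m + k).+1`! * k`! * m`!)%N%:R.
Proof.
have nz n : (n`!%:R : rat) != 0 by rewrite Num.Theory.pnatr_eq0 -lt0n fact_gt0.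
have nzS n : (n.+1%:R : rat) != 0 by rewrite Num.Theory.pnatr_eq0.
have -> : 'C(m + k, m)%:R = (m + k)`!%:R / (m`!%:R * k`!%:R) :> rat.
  apply: canRL (mulfK _) _; first by rewrite mulf_neq0.
  by rewrite -!natrM -(bin_fact (leq_addr k m)) addKn.
rewrite /catalan; move: (m + k)%N => n.
rewrite (factS n.+1) (factS n) !natrM.
by field; rewrite !nz -(natrD _ 1) -(natrD _ 2) !nzS.
Qed.

Theorem theorem4p6 (i j : nat) (hi : (1 <= i)%N) :
  betti_J_2_infty i j =
    if (2 * i <= j)%N then
      ((2 * (j - i))`!)%N%:R /
        ((j - i + 1) * (j - i) * (j - i)`! * (j - 2 * i)`! * (i - 1)`!)%N%:R
    else 0.
Proof.
rewrite /betti_J_2_infty G_2_infty_catalan var_xM.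
case: i hi => // i _; case: ifPn => [le_ij|]; last rewrite -ltnNge => lt_ji.
  have [k ->] : exists k, j = (i + (i + k)).+2 by exists (j - 2 * i.+1)%N; lia.
  rewrite !var_tM subst_uE /= addKn catalan_binomial.
  have -> : ((i + (i + k)).+2 - i.+1 = (i + k).+1)%N by lia.
  have -> : ((i + (i + k)).+2 - 2 * i.+1 = k)%N by lia.
  by rewrite addn1 subn1.
case: j lt_ji => [|[|j]] lt_ji; rewrite !var_tM // subst_uE.
by rewrite bin_small ?mulr0 //; lia.
Qed.
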